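(* For any integer $n\ge 0$, we have \[\mathrm{pod}_{-3}(3n+2)\equiv 6\,\mathrm{pod}(9n+5) \pmod{9},\] \[\mathrm{pod}_{-3}(3n+1)\equiv 3\,\mathrm{pod}(9n+2) \pmod{18}.\]
   Context: $\mathrm{pod}(n)$ denotes the number of partitions of $n$ in which the odd parts are distinct, and $\mathrm{pod}_{-3}(n)$ denotes the number of partition triples of $n$ in which the odd parts in each of the three partitions are distinct. Equivalently, as formal power series, \[\sum_{n=0}^{\infty}\mathrm{pod}(n)q^n=\frac{(-q;q^2)_\infty}{(q^2;q^2)_\infty}=\frac{1}{\psi(-q)},\qquad \sum_{n=0}^{\infty}\mathrm{pod}_{-3}(n)q^n=\frac{(-q;q^2)_\infty^3}{(q^2;q^2)_\infty^3}=\frac{1}{\psi(-q)^3},\] where $\psi(q)=\sum_{n=0}^{\infty}q^{n(n+1)/2}$ and $(a;q)_\infty=\prod_{k\ge 0}(1-aq^k)$. *)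

(* Defs.v *)
From mathcomp Require Import all_boot.

Set Implicit Arguments.
Unset Strict Implicit.
Unset Printing Implicit Defensive.

(* Partitions are nonincreasing lists of positive parts; a partition of n is
   one whose parts sum to n, and the empty list is the partition of 0. *)
Definition is_partition (s : seq nat) : bool := sorted geq s && (0 \notin s).

Definition odd_parts_distinct (s : seq nat) : bool :=
  uniq [seq x <- s | odd x].

Definition pod_partition (s : seq nat) : bool :=
  is_partition s && odd_parts_distinct s.

(* A partition of some m <= n has at most n parts, each of them at most n, so
   all such partitions live in this finite type (see [bounded_partition]). *)
Definition bounded_seq (n : nat) : finType := n.-bseq 'I_n.+1.

Definition parts (n : nat) (b : bounded_seq n) : seq nat :=
  map val (b : n.-bseq 'I_n.+1).

Definition pod (n : nat) : nat :=
  #|[set b : bounded_seq n | pod_partition (parts b) & sumn (parts b) == n]|.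

(* This is pod_{-3}: the three sizes add up to n. *)
Definition pod_triple (n : nat) : nat :=
  #|[set t : bounded_seq n * bounded_seq n * bounded_seq n |
      [&& pod_partition (parts t.1.1), pod_partition (parts t.1.2),
          pod_partition (parts t.2)
        & sumn (parts t.1.1) + sumn (parts t.1.2) + sumn (parts t.2) == n]]|.

Lemma parts_inj (n : nat) : injective (@parts n).
Proof. by move=> a b /(inj_map val_inj) /val_inj. Qed.

Lemma bounded_partition (n : nat) (s : seq nat) :
  is_partition s -> sumn s <= n -> exists b : bounded_seq n, parts b = s.
Proof.
case/andP=> _ s0 sn.
have sz : size s <= n.
  apply: leq_trans sn; elim: s s0 => //= x s IHs.
  rewrite inE negb_or eq_sym -lt0n => /andP[x0 /IHs le].
  by rewrite -add1n leq_add.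
have bd x : x \in s -> x < n.+1.
  rewrite ltnS => xs; apply: leq_trans sn; elim: s xs {s0 sz} => //= y s IHs.
  rewrite inE => /orP[/eqP <-|/IHs le]; first exact: leq_addr.
  exact: leq_trans le (leq_addl _ _).
have sz' : size (map (@inord n) s) <= n by rewrite size_map.
exists (Bseq sz'); rewrite /parts /= -map_comp -[RHS]map_id.
by apply/eq_in_map => x /bd xn /=; rewrite inordK.
Qed.

(* Main.v *)
Require Import Defs.
From mathcomp Require Import all_boot.
From HB Require Import structures.
From mathcomp Require Import all_algebra boolp zify ring.

Set Implicit Arguments.
Unset Strict Implicit.
Unset Printing Implicit Defensive.

(** Write [x = psi(-q)], [s = psi(-q^3)], [P = 1/x], and let [S] be the
    substitution [q |-> q^3]. Triangular numbers are never 2 modulo 3, and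
    [T(3k+1) = 9 T(k) + 1], so [x = S A - q S s] with [A] the series of the
    coefficients of [x] at multiples of 3. Hence, with [D = A^3 - q s^3],
    [S D = x (a^2 + a b + b^2)] for [a = S A], [b = q S s], which dissects [P].

    Modulo 9: [3 x^3 = 3 S x] gives [3 D = 3 x], while [x^3 = S D - 3 a b x]
    yields [P^3 = 1/S D + 3 a b (a - b) / (S D)^2]; everything else is read off.

    Modulo 2: an involution coming from conjugation in [Z[sqrt(-3)]] on the
    solutions of [T(j) + 3 T(k) = N] gives [x s = x^4 + q s^4]. Its section at
    multiples of 3 is [A x = A^4], so [A^3 = x] and [D s = x^4], and both sides
    of the parity statement become monomials in [A], [s], [P]. *)

Import GRing.Theory.

(** * Formal power series *)

Record fps (R : comNzRingType) := Fps { coef :> nat -> R }.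

Section Ring.
Local Open Scope ring_scope.
Variable R : comNzRingType.
Implicit Types f g h : fps R.

Lemma fpsP f g : (forall n, f n = g n) -> f = g.
Proof. by case: f g => [f] [g] /= fg; congr Fps; apply/funext. Qed.

HB.instance Definition _ := gen_eqMixin (fps R).
HB.instance Definition _ := gen_choiceMixin (fps R).

Definition fps_zero : fps R := Fps (fun=> 0).
Definition fps_opp f : fps R := Fps (fun n => - f n).
Definition fps_add f g : fps R := Fps (fun n => f n + g n).
Definition fps_one : fps R := Fps (fun n => (n == 0%N)%:R).
Definition fps_mul f g : fps R := Fps (fun n => \sum_(i < n.+1) f i * g (n - i)%N).

Fact fps_addA : associative fps_add.
Proof. by move=> f g h; apply/fpsP => n; apply: addrA. Qed.
Fact fps_addC : commutative fps_add.
Proof. by move=> f g; apply/fpsP => n; apply: addrC. Qed.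
Fact fps_add0 : left_id fps_zero fps_add.
Proof. by move=> f; apply/fpsP => n; apply: add0r. Qed.
Fact fps_addN : left_inverse fps_zero fps_opp fps_add.
Proof. by move=> f; apply/fpsP => n; apply: addNr. Qed.
HB.instance Definition _ :=
  GRing.isZmodule.Build (fps R) fps_addA fps_addC fps_add0 fps_addN.

(** A coefficient of a product involves only finitely many terms, so commutativity and associativity
    are inherited from polynomials by truncating far enough. *)
Let trunc m f : {poly R} := \poly_(i < m) f i.

Let coef_mul_trunc m f g n : (n < m)%N -> fps_mul f g n = (trunc m f * trunc m g)`_n.
Proof.
move=> nm; rewrite coefM; apply: eq_bigr => i _ /=.
by rewrite !coef_poly (leq_ltn_trans _ nm) ?(leq_ltn_trans _ nm) ?leq_subr // -ltnS.
Qed.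

Let trunc_mul m f g n : (n < m)%N ->
  (trunc m (fps_mul f g))`_n = (trunc m f * trunc m g)`_n.
Proof. by move=> nm; rewrite coef_poly nm; apply: coef_mul_trunc. Qed.

Fact fps_mulC : commutative fps_mul.
Proof.
by move=> f g; apply/fpsP => n; rewrite !(@coef_mul_trunc n.+1) // mulrC.
Qed.
Fact fps_mulA : associative fps_mul.
Proof.
move=> f g h; apply/fpsP => n; rewrite !(@coef_mul_trunc n.+1) //.
transitivity ((trunc n.+1 f * trunc n.+1 g * trunc n.+1 h)`_n).
  rewrite -mulrA ![(trunc _ f * _)`_n]coefM; apply: eq_bigr => i _.
  by rewrite trunc_mul // ltnS leq_subr.
rewrite ![(_ * trunc _ h)`_n]coefM; apply: eq_bigr => i _.
by rewrite trunc_mul.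
Qed.
Fact fps_mul1 : left_id fps_one fps_mul.
Proof.
move=> f; apply/fpsP => n /=; rewrite big_ord_recl /= mul1r subn0 big1 ?addr0 //.
by move=> i _; rewrite mul0r.
Qed.
Fact fps_mulDl : left_distributive fps_mul fps_add.
Proof.
move=> f g h; apply/fpsP => n /=; rewrite -big_split /=.
by apply: eq_bigr => i _; rewrite mulrDl.
Qed.
Fact fps_one_neq0 : fps_one != fps_zero.
Proof. by apply/eqP => /(congr1 (fun f : fps R => f 0%N)) /eqP; rewrite oner_eq0. Qed.
HB.instance Definition _ := GRing.Zmodule_isComNzRing.Build (fps R)
  fps_mulA fps_mulC fps_mul1 fps_mulDl fps_one_neq0.

Lemma fpsD f g n : (f + g) n = f n + g n. Proof. by []. Qed.
Lemma fpsN f n : (- f) n = - f n. Proof. by []. Qed.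
Lemma fps1 n : (1 : fps R) n = (n == 0%N)%:R. Proof. by []. Qed.
Lemma fpsM f g n : (f * g) n = \sum_(i < n.+1) f i * g (n - i)%N.
Proof. by []. Qed.
Lemma fps_sum I (r : seq I) (P : pred I) (F : I -> fps R) n :
  (\sum_(i <- r | P i) F i) n = \sum_(i <- r | P i) F i n.
Proof. by elim/big_rec2: _ => // i _ y _ <-. Qed.

Definition fpsC c : fps R := Fps (fun n => if n is 0 then c else 0).
Definition fpsX : fps R := Fps (fun n => (n == 1%N)%:R).
Definition shift f : fps R := Fps (fun n => f n.+1).

Lemma fpsCM c f n : (fpsC c * f) n = c * f n.
Proof.
rewrite fpsM big_ord_recl /= subn0 big1 ?addr0 // => i _.
by rewrite mul0r.
Qed.
Lemma fpsXM f n : (fpsX * f) n = if n is n'.+1 then f n' else 0.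
Proof.
rewrite fpsM big_ord_recl /= mul0r add0r; case: n => [|n]; first by rewrite big_ord0.
rewrite big_ord_recl /= mul1r subSS subn0 big1 ?addr0 // => i _.
by rewrite mul0r.
Qed.
Lemma fpsXnM k f n : (fpsX ^+ k * f) n = if (k <= n)%N then f (n - k)%N else 0.
Proof.
elim: k n => [|k IHk] n; first by rewrite mul1r subn0.
by rewrite exprS -mulrA fpsXM; case: n => [|n]; rewrite ?ltnS ?subSS.
Qed.
Lemma fpsXn k n : (fpsX ^+ k) n = (n == k)%:R.
Proof.
rewrite -[fpsX ^+ k]mulr1 fpsXnM fps1 subn_eq0.
by case: ltngtP.
Qed.
Lemma fps_decomp f : f = fpsC (f 0%N) + fpsX * shift f.
Proof.
by apply/fpsP => -[|n]; rewrite fpsD fpsXM /= ?addr0 ?add0r.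
Qed.
Lemma fpsM0 f g : (f * g) 0%N = f 0%N * g 0%N.
Proof. by rewrite fpsM big_ord1. Qed.
Lemma fpsCD c d : fpsC (c + d) = fpsC c + fpsC d.
Proof. by apply/fpsP => -[|n]; rewrite fpsD //= addr0. Qed.
Lemma fpsC1 : fpsC 1 = 1. Proof. by apply/fpsP => -[]. Qed.
Lemma fpsCXn c k : fpsC (c ^+ k) = fpsC c ^+ k.
Proof.
elim: k => [|k IHk]; first exact: fpsC1.
by apply/fpsP => -[|n]; rewrite !exprS -IHk fpsCM //= mulr0.
Qed.
Lemma fpsC_nat k : fpsC k%:R = k%:R.
Proof.
elim: k => [|k IHk]; first by apply/fpsP => -[].
by rewrite -addn1 !natrD fpsCD IHk fpsC1.
Qed.
Lemma natr_fps_eq0 k : k%:R = 0 :> R -> k%:R = 0 :> fps R.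
Proof. by move=> k0; rewrite -fpsC_nat k0; apply: (fpsC_nat 0). Qed.
Lemma fps_natM k f n : (k%:R * f) n = k%:R * f n.
Proof. by rewrite -fpsC_nat fpsCM. Qed.
Lemma coef_sumX (I : finType) (e : I -> nat) n :
  (\sum_i fpsX ^+ e i : fps R) n = #|[set i | e i == n]|%:R.
Proof.
rewrite fps_sum -sum1_card natr_sum [RHS]big_mkcond; apply: eq_bigr => i _.
by rewrite fpsXn inE eq_sym; case: eqP.
Qed.
End Ring.

Arguments fpsX {R}.

(** * Congruence modulo powers of the variable, and inverses *)

Section Truncation.
Local Open Scope ring_scope.
Variable R : comNzRingType.
Implicit Types f g h : fps R.

Definition eq_upto m f g := forall n, (n < m)%N -> f n = g n.

Lemma eq_uptoM m f f' g g' :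
  eq_upto m f f' -> eq_upto m g g' -> eq_upto m (f * g) (f' * g').
Proof.
move=> ff' gg' n nm; rewrite !fpsM; apply: eq_bigr => i _.
by rewrite ff' ?gg' ?(leq_ltn_trans _ nm) ?leq_subr // -ltnS.
Qed.

Lemma eq_uptoX m f f' k : eq_upto m f f' -> eq_upto m (f ^+ k) (f' ^+ k).
Proof.
by move=> ff'; elim: k => [|k IHk] //; rewrite !exprS; apply: eq_uptoM.
Qed.

(** With zero constant term, [f] is [fpsX * shift f], so [fpsX ^+ k] divides [f ^+ k]. *)
Lemma fps_geometric f k :
  f 0%N = 0 -> eq_upto k (f ^+ k) 0.
Proof.
move=> f0 n nk; rewrite (fps_decomp f) f0.
have ->: fpsC 0 = 0 :> fps R by apply/fpsP => -[].
by rewrite add0r exprMn fpsXnM leqNgt nk.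
Qed.

Lemma fps_inverse f : f 0%N = 1 -> exists g, f * g = 1.
Proof.
move=> f0; pose h := 1 - f.
have h0 : h 0%N = 0 by rewrite fpsD fpsN f0 fps1 subrr.
pose G k : fps R := \sum_(i < k) h ^+ i.
(* The geometric series of [h], read on the diagonal: coefficient [n] no longer changes once the
   powers up to [n] are summed. *)
exists (Fps (fun n => G n.+1 n)); apply/fpsP => n.
have eqG : eq_upto n.+1 (Fps (fun n => G n.+1 n)) (G n.+1).
  move=> m; rewrite ltnS => mn /=; rewrite /G !fps_sum.
  rewrite -!(big_mkord xpredT (fun i => (h ^+ i) m)).
  rewrite [RHS](@big_cat_nat _ _ _ m.+1) //=.
  have -> : \sum_(m.+1 <= i < n.+1) (h ^+ i) m = 0; last by rewrite addr0.
  rewrite big_nat_cond big1 // => i /andP[/andP[mi _] _].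
  exact: fps_geometric.
rewrite (eq_uptoM (fun m _ => erefl (f m)) eqG) //.
have -> : f * G n.+1 = 1 - h ^+ n.+1.
  by rewrite -(opprB _ 1) subrX1 -mulNr; congr (_ * _); rewrite /h; ring.
by rewrite fpsD fpsN fps_geometric // subr0.
Qed.

Lemma fps_mulI f : f 0%N = 1 -> injective ( *%R f).
Proof.
case/fps_inverse=> g fg u v /(congr1 ( *%R g)).
by rewrite !mulrA [g * f]mulrC fg !mul1r.
Qed.
End Truncation.

(** * The substitution of [q^p] for [q] *)

Section Dilation.
Local Open Scope ring_scope.
Variable R : comNzRingType.
Implicit Types f g h : fps R.

Definition dil p f : fps R := Fps (fun n => if (p %| n)%N then f (n %/ p)%N else 0).

Arguments dil : simpl never.

Lemma dilE p f n : dil p f n = if (p %| n)%N then f (n %/ p)%N else 0.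
Proof. by []. Qed.

Variable p : nat.
Hypothesis p_gt0 : (0 < p)%N.

Lemma dil_mul f k : dil p f (p * k)%N = f k.
Proof. by rewrite dilE dvdn_mulr // mulKn. Qed.

Lemma dil_ndvd f n : ~~ (p %| n)%N -> dil p f n = 0.
Proof. by rewrite dilE => /negbTE ->. Qed.

Lemma dilD f g : dil p (f + g) = dil p f + dil p g.
Proof. by apply/fpsP => n; rewrite !(fpsD, dilE); case: ifP; rewrite ?addr0. Qed.

Lemma dilN f : dil p (- f) = - dil p f.
Proof. by apply/fpsP => n; rewrite !(fpsN, dilE); case: ifP; rewrite ?oppr0. Qed.

Lemma dilB f g : dil p (f - g) = dil p f - dil p g.
Proof. by rewrite dilD dilN. Qed.

Lemma dilC c : dil p (fpsC c) = fpsC c.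
Proof.
apply/fpsP => -[|n]; rewrite dilE /=; first by rewrite dvdn0 div0n.
by case: ifP => // pn; case E: (_ %/ _)%N => //; have := divnK pn; rewrite E.
Qed.

Lemma dil1 : dil p 1 = 1. Proof. by rewrite -fpsC1 dilC. Qed.

Lemma dilXM f : dil p (fpsX * f) = fpsX ^+ p * dil p f.
Proof.
apply/fpsP => n; rewrite fpsXnM !dilE fpsXM.
case: leqP => pn.
  rewrite -{1 2}(subnK pn) dvdn_addl // divnDr // divnn p_gt0 addn1.
  by case: ifP.
case: ifP => // dn; case E: (_ %/ _)%N => //.
by move: pn; rewrite -(divnK dn) E mulSn ltnNge leq_addr.
Qed.

Lemma dil_decomp f : dil p f = fpsC (f 0%N) + fpsX ^+ p * dil p (shift f).
Proof. by rewrite {1}(fps_decomp f) dilD dilC dilXM. Qed.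

Lemma dilCM c f : dil p (fpsC c * f) = fpsC c * dil p f.
Proof. by apply/fpsP => n; rewrite !(fpsCM, dilE); case: ifP; rewrite ?mulr0. Qed.

(** Peeling off the constant term of [f] reduces coefficient [n] for [f] to coefficient [n - p] for
    [shift f], whence the strong induction. *)
Lemma dilM f g : dil p (f * g) = dil p f * dil p g.
Proof.
apply/fpsP => n; elim/ltn_ind: n f => n IHn f.
rewrite [in RHS]dil_decomp {1}(fps_decomp f) mulrDl -mulrA dilD dilXM dilCM.
rewrite mulrDl -mulrA !fpsD !fpsXnM; congr (_ + _).
by case: leqP => // pn; apply: IHn; lia.
Qed.

Lemma dilX : dil p fpsX = fpsX ^+ p :> fps R.
Proof. by rewrite -{1}[fpsX]mulr1 dilXM dil1 mulr1. Qed.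

End Dilation.

Section DilationMorphism.
Local Open Scope ring_scope.
Variables (R : comNzRingType) (p : nat).

Fact dil_zmod : zmod_morphism (@dil R p.+1).
Proof. by move=> f g; apply: dilB. Qed.
Fact dil_monoid : monoid_morphism (@dil R p.+1).
Proof. by split; [apply: dil1|move=> f g; apply: dilM]. Qed.
HB.instance Definition _ := GRing.isZmodMorphism.Build _ _ _ dil_zmod.
HB.instance Definition _ := GRing.isMonoidMorphism.Build _ _ _ dil_monoid.

Lemma dil_sumX (I : finType) (e : I -> nat) :
  dil p.+1 (\sum_i fpsX ^+ e i : fps R) = \sum_i fpsX ^+ (p.+1 * e i).
Proof.
by rewrite rmorph_sum; apply: eq_bigr => i _; rewrite rmorphXn /= dilX // exprM.
Qed.

Lemma eq_upto_dil m (f g : fps R) :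
  eq_upto m f g -> eq_upto m (dil p.+1 f) (dil p.+1 g).
Proof.
move=> fg n nm; rewrite !dilE; case: ifP => // _.
by apply: fg; apply: leq_ltn_trans (leq_div _ _) nm.
Qed.
End DilationMorphism.

(** * Dissection by exponents modulo 3 *)

Section Dissection.
Local Open Scope ring_scope.
Variable R : comNzRingType.
Implicit Types f g h : fps R.

Definition sect j f : fps R := Fps (fun n => f (3 * n + j)%N).

Arguments sect : simpl never.

Lemma sectE j f n : sect j f n = f (3 * n + j)%N. Proof. by []. Qed.

Lemma dissection f :
  f = dil 3 (sect 0 f) + fpsX * dil 3 (sect 1 f) + fpsX ^+ 2 * dil 3 (sect 2 f).
Proof.
apply/fpsP => n; rewrite -[fpsX in fpsX * _]expr1 !fpsD !fpsXnM.
have := ltn_pmod n (isT : (0 < 3)%N); have := divn_eq n 3.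
move: (n %/ 3)%N (n %% 3)%N => k r -> {n}; rewrite mulnC.
case: r => [|[|[|]]] // _.
- rewrite addn0 dil_mul // sectE addn0.
  by case: leqP => ?; case: leqP => ?; rewrite ?dil_ndvd ?addr0 //; lia.
- rewrite addnK addn_gt0 orbT dil_mul // sectE dil_ndvd ?add0r; last lia.
  by case: leqP => ?; rewrite ?dil_ndvd ?addr0 //; lia.
- rewrite addnK addn_gt0 leq_addl orbT dil_mul // sectE dil_ndvd ?add0r; last lia.
  by rewrite dil_ndvd ?add0r //; lia.
Qed.

(** Uniqueness of the dissection: once [ring] has put a series in this shape, its three sections can
    be read off. *)
Lemma sect_dissection f0 f1 f2 f :
  f = dil 3 f0 + fpsX * dil 3 f1 + fpsX ^+ 2 * dil 3 f2 ->
  [/\ sect 0 f = f0, sect 1 f = f1 & sect 2 f = f2].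
Proof.
move=> ->; split; apply/fpsP => n; rewrite -[fpsX in fpsX * _]expr1 sectE !fpsD !fpsXnM.
- rewrite addn0 dil_mul //.
  by case: leqP => ?; case: leqP => ?; rewrite ?dil_ndvd ?addr0 //; lia.
- rewrite addnK addn_gt0 orbT dil_mul // dil_ndvd ?add0r; last lia.
  by case: leqP => ?; rewrite ?dil_ndvd ?addr0 //; lia.
- rewrite addnK addn_gt0 leq_addl orbT dil_mul // dil_ndvd ?add0r; last lia.
  by rewrite dil_ndvd ?add0r //; lia.
Qed.

Lemma sect_natM j k f : sect j (k%:R * f) = k%:R * sect j f.
Proof. by apply/fpsP => n; rewrite sectE !fps_natM. Qed.
End Dissection.

(** * Frobenius congruences for power series *)

Section Frobenius.
Local Open Scope ring_scope.
Variable R : comNzRingType.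

(** The mixed terms of the cube of [c + q g] carry a factor 3, which the outer 3 turns into 9; the
    term [q^3 g^3] is left to the induction. *)
Lemma fps_cube : 9 = 0 :> R -> (forall c : R, 3 * c ^+ 3 = 3 * c) ->
  forall f : fps R, 3 * f ^+ 3 = 3 * dil 3 f.
Proof.
move=> /natr_fps_eq0 R9 cube f; apply/fpsP => n; elim/ltn_ind: n f => n IHn f.
rewrite dil_decomp // {1}(fps_decomp f); move: (f 0%N) (shift f) => c g.
have -> : 3 * (fpsC c + fpsX * g) ^+ 3 =
    3 * fpsC c ^+ 3 + fpsX ^+ 3 * (3 * g ^+ 3) +
    9 * (fpsC c ^+ 2 * fpsX * g + fpsC c * fpsX ^+ 2 * g ^+ 2) by ring.
rewrite R9 mul0r addr0 -fpsCXn mulrDr [3 * (fpsX ^+ 3 * _)]mulrCA 2!fpsD 2!fpsXnM.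
congr (_ + _); first by rewrite !fps_natM; case: n {IHn} => [|n] //=; apply: cube.
by case: leqP => // n3; apply: IHn; lia.
Qed.

Lemma fps_square : 2 = 0 :> R -> (forall c : R, c ^+ 2 = c) ->
  forall f : fps R, f ^+ 2 = dil 2 f.
Proof.
move=> /natr_fps_eq0 R2 square f; apply/fpsP => n; elim/ltn_ind: n f => n IHn f.
rewrite dil_decomp // {1}(fps_decomp f); move: (f 0%N) (shift f) => c g.
have -> : (fpsC c + fpsX * g) ^+ 2 =
    fpsC c ^+ 2 + fpsX ^+ 2 * g ^+ 2 + 2 * (fpsC c * fpsX * g) by ring.
rewrite R2 mul0r addr0 -fpsCXn square 2!fpsD 2!fpsXnM; congr (_ + _).
by case: leqP => // n2; apply: IHn; lia.
Qed.
End Frobenius.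

(** * Counting partitions *)

Section Counting.
Implicit Types (m n : nat) (s : seq nat).

Definition pod_of m n s :=
  [&& pod_partition s, all (geq m) s & sumn s == n].

Definition pods m n : seq (seq nat) :=
  [seq parts b | b <- enum (bounded_seq n) & pod_of m n (parts b)].

Lemma mem_pods m n s : (s \in pods m n) = pod_of m n s.
Proof.
apply/mapP/idP => [[b]|]; first by rewrite mem_filter => /andP[? _] ->.
move=> sP; have/and3P[/andP[ps _] _ /eqP sn] := sP.
have [b sb] := bounded_partition ps (eq_leq sn).
by exists b; rewrite // mem_filter sb sP mem_enum.
Qed.

Lemma uniq_pods m n : uniq (pods m n).
Proof. by rewrite map_inj_uniq; [apply/filter_uniq/enum_uniq|apply: parts_inj]. Qed.

Lemma all_leq_sumn s : all (geq (sumn s)) s.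
Proof.
elim: s => //= x s IHs; rewrite leq_addr; apply: sub_all IHs => y /= ys.
exact: leq_trans ys (leq_addl _ _).
Qed.

Lemma pod_ofE m n s : n <= m -> pod_of m n s = pod_partition s && (sumn s == n).
Proof.
move=> nm; rewrite /pod_of; case: (_ =P n) => [sn|]; last by rewrite !andbF.
congr (_ && _); rewrite andbT; apply: sub_all (all_leq_sumn s) => x /= xs.
by rewrite (leq_trans xs) ?sn.
Qed.

(** The count does not depend on the ambient bound [N]. This matters for triples, whose components
    all live in [bounded_seq n] although their sizes differ. *)
Lemma card_pods N n : n <= N ->
  #|[set b : bounded_seq N | pod_partition (parts b) & sumn (parts b) == n]|
  = size (pods n n).
Proof.
move=> nN; rewrite cardE -(size_map (@parts N)); apply/perm_size/uniq_perm.
- by rewrite map_inj_uniq; [apply: enum_uniq|apply: parts_inj].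
- exact: uniq_pods.
move=> s; rewrite mem_pods pod_ofE //; apply/mapP/idP => [[b]|].
  by rewrite mem_enum inE => ? ->.
move=> sP; have/andP[/andP[ps _] /eqP sn] := sP.
have [|b sb] := @bounded_partition N s ps; first by rewrite sn.
by exists b; rewrite // mem_enum inE sb.
Qed.

(** An even largest part may occur again, so the bound stays; an odd one may not, so the bound drops
    to [m]. *)
Lemma pod_of_cons m n s :
  pod_of m.+1 n (m.+1 :: s) =
  (m < n) && pod_of (if odd m.+1 then m else m.+1) (n - m.+1) s.
Proof.
rewrite /pod_of /pod_partition /is_partition /odd_parts_distinct /= leqnn /=.
rewrite path_sortedE; last by move=> x y z /= xy zx; apply: leq_trans zx xy.
rewrite inE /=.
have -> : (m.+1 + sumn s == n) = (m < n) && (sumn s == n - m.+1) by lia.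
case: (m < n); last by rewrite !andbF.
(* This trades the distinctness of the odd part [m.+1] for the smaller bound. *)
have all_geq_notin : all (geq m) s = all (geq m.+1) s && (m.+1 \notin s).
  elim: s => //= x s ->; rewrite inE negb_or -!andbA.
  case: (m.+1 \notin s); rewrite ?andbT ?andbF //.
  by case: (all _ _); rewrite ?andbT ?andbF //; lia.
case: (boolP (odd m)) => odd_m /=; last first.
  rewrite all_geq_notin mem_filter /= odd_m /=.
  by case: (all _ _); case: (m.+1 \notin _); rewrite /= -?andbA ?andbF.
by case: (all _ _); rewrite /= -?andbA ?andbF.
Qed.

(** The head is the largest part, so the bound [m.+1] improves to [m] unless the head equals
    [m.+1]. *)
Lemma pod_of_succ m n s :
  pod_of m.+1 n s = pod_of m n s || (head 0 s == m.+1) && pod_of m.+1 n s.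
Proof.
case: eqP => [|/eqP]; last first.
  rewrite orbF /pod_of; case: (boolP (pod_partition s)) => //=.
  case: s => //= x s /andP[/andP[+ _] _] xm /=.
  rewrite [sorted _ _]/= path_sortedE; last first.
    by move=> a b c /= ab ca; apply: leq_trans ca ab.
  case/andP=> sx _; rewrite (_ : (x <= m.+1) = (x <= m)); last by lia.
  case: (leqP x m) => //= le_xm; congr (_ && _).
  transitivity true; last apply/esym.
    by apply: sub_all sx => y /= yx; rewrite (leq_trans yx) // ltnW.
  by apply: sub_all sx => y /= yx; rewrite (leq_trans yx).
case: s => //= x s ->; rewrite (_ : pod_of m n _ = false) //.
by rewrite /pod_of /= ltnn /= andbF.
Qed.

Lemma size_pods_succ m n : size (pods m.+1 n) = size (pods m n) +
  (if m < n then size (pods (if odd m.+1 then m else m.+1) (n - m.+1)) else 0).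
Proof.
set m' := (if odd _ then _ else _).
transitivity (size (pods m n ++
  if m < n then [seq m.+1 :: s | s <- pods m' (n - m.+1)] else [::])).
  apply/perm_size/uniq_perm; first exact: uniq_pods.
    rewrite cat_uniq uniq_pods /=; case: ifP => // mn.
    rewrite map_inj_uniq ?uniq_pods ?andbT; last by move=> a b [].
    by apply/hasPn => _ /mapP[s _ ->]; rewrite mem_pods /pod_of /= ltnn /= andbF.
  move=> s; rewrite mem_cat !mem_pods pod_of_succ; congr (_ || _).
  case: s => [|x s]; first by case: ifP => // _; apply/esym/mapP => -[].
  rewrite /=; apply/andP/idP => [[/eqP ->]|].
    by rewrite pod_of_cons => /andP[-> sP]; rewrite map_f ?mem_pods.
  case: ifP => // mn /mapP[s' + [-> ->]]; rewrite mem_pods eqxx => s'P.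
  by rewrite pod_of_cons mn.
by rewrite size_cat; case: ifP => // _; rewrite size_map.
Qed.

Lemma size_pods0 n : size (pods 0 n) = (n == 0).
Proof.
transitivity (size (if n == 0 then [:: [::]] else [::] : seq (seq nat)));
  last by case: eqP.
apply/perm_size/uniq_perm; [exact: uniq_pods|by case: eqP|].
move=> s; rewrite mem_pods /pod_of; case: s => [|x s] /=.
  by rewrite eq_sym; case: eqP.
rewrite (_ : _ && _ = false); first by case: eqP.
by apply/negbTE/negP => /and3P[/andP[/andP[_]]]; rewrite inE negb_or; case: x.
Qed.

End Counting.

(** * Gauss's identity *)

Definition tri k := (k * k.+1)./2.

Arguments tri : simpl never.

Lemma tri_double k : ((tri k).*2 = k * k.+1)%N.
Proof. by rewrite /tri halfK oddM /= andbN subn0. Qed.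

Lemma triS k : tri k.+1 = (tri k + k.+1)%N.
Proof. by have := tri_double k; have := tri_double k.+1; lia. Qed.

Lemma leq_tri k : (k <= tri k)%N.
Proof. by elim: k => // k IHk; rewrite triS; lia. Qed.

Lemma ltn_tri : {homo tri : j k / (j < k)%N}.
Proof. by apply: homo_ltn => [? ? ?|k]; [apply: ltn_trans|rewrite triS; lia]. Qed.

Lemma tri_inj : injective tri.
Proof.
by move=> j k jk; case: (ltngtP j k) => // /ltn_tri; rewrite jk ltnn.
Qed.

(* Shanks's finite form of Gauss's identity, where
   [p n = \prod_(1 <= k <= n) (1 - y ^ (2 k - 1)) / (1 - y ^ (2 k))]. *)
Section Shanks.
Local Open Scope ring_scope.
Variables (A : comNzRingType) (y : A) (p : nat -> A).
Hypothesis p0 : p 0 = 1.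
Hypothesis pS : forall n,
  p n.+1 * (1 - y ^+ n.*2.+2) = p n * (1 - y ^+ n.*2.+1).
Hypothesis reg : forall n, injective ( *%R (1 - y ^+ n.*2.+2)).

(** By [pS], the summand is the difference of consecutive values of [p s * (1 - y ^+ s.*2.+1) * y ^+
    (s.+1 * n.*2.+1)]; the first summand has only the subtracted value because [1 - y ^+ 0]
    vanishes. *)
Let shanks_telescope n m :
  \sum_(s < m.+1) p s * y ^+ (s * n.*2.+1) *
     ((1 - y ^+ s.*2) - y ^+ n.*2.+1 * (1 - y ^+ s.*2.+1))
  = - (p m * (1 - y ^+ m.*2.+1) * y ^+ (m.+1 * n.*2.+1)).
Proof.
elim: m => [|m IHm].
  by rewrite big_ord1 p0 mul0n mul1n !expr0 expr1; ring.
rewrite big_ord_recr /= {}IHm doubleS [(m.+2 * _)%N]mulSn exprD.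
have E := pS m; set u := y ^+ n.*2.+1; set v := y ^+ (m.+1 * _).
transitivity (v * (p m.+1 * (1 - y ^+ m.*2.+2) - p m * (1 - y ^+ m.*2.+1))
  - p m.+1 * (1 - y ^+ m.*2.+3) * (u * v)); first by ring.
by rewrite E subrr mulr0 add0r.
Qed.

(** Induction on [n], multiplying by [1 - y ^+ n.*2.+2] to avoid division. Of the two new powers on
    the left, the one with exponent [tri n.*2] comes from the summand [s = n] of [K], and the one
    with exponent [tri n.*2.+1] from the boundary term of the telescoping sum. *)
Lemma shanks n : p n * \sum_(s < n.*2) y ^+ tri s =
  \sum_(s < n) p s * y ^+ (s * n.*2.+1).
Proof.
elim: n => [|n IHn]; first by rewrite !big_ord0 mulr0.
apply: (reg (n := n)); rewrite mulrA [_ * p _]mulrC pS.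
have E2 := shanks_telescope n n; set u := y ^+ n.*2.+1 in IHn E2 *.
have -> : y ^+ n.*2.+2 = y * u by rewrite -exprS.
rewrite doubleS 2!big_ord_recr /= triS [y ^+ (_ + _)]exprD -/u.
have -> : tri n.*2 = (n * n.*2.+1)%N by have := tri_double n.*2; lia.
set K := \sum_(s < n.+1) p s * y ^+ (s * n.*2.+1).
have KE : K = p n * (\sum_(s < n.*2) y ^+ tri s + y ^+ (n * n.*2.+1)).
  by rewrite mulrDr IHn /K big_ord_recr.
set H := (X in _ = _ * X).
have HE : (1 - u) * K - (1 - y * u) * H
    = - (p n * (1 - u) * y ^+ (n.+1 * n.*2.+1)).
  rewrite -E2 !mulr_sumr -sumrB; apply: eq_bigr => s _.
  rewrite (_ : (s * n.*2.+3)%N = (s * n.*2.+1 + s.*2)%N); last by lia.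
  by rewrite exprD exprS; ring.
have {}HE : (1 - y * u) * H = (1 - u) * K + p n * (1 - u) * y ^+ (n.+1 * n.*2.+1).
  by rewrite -[LHS](subKr ((1 - u) * K)) HE opprK.
by rewrite HE KE mulSn exprD -/u; ring.
Qed.
End Shanks.

Section Psi.
Local Open Scope ring_scope.
Variable R : comNzRingType.

Definition is_tri n := [exists k : 'I_n.+1, tri k == n].

Lemma is_triP n : reflect (exists k, tri k = n) (is_tri n).
Proof.
apply: (iffP existsP) => [[k /eqP]|[k kn]]; first by exists k.
have kn' : (k < n.+1)%N by rewrite ltnS -kn leq_tri.
by exists (Ordinal kn'); rewrite /= kn.
Qed.

(* The paper's [psi(-q)]. *)
Definition psi_neg : fps R := Fps (fun n => (-1) ^+ n * (is_tri n)%:R).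

Lemma expr_XN k : (- fpsX : fps R) ^+ k = (-1) ^+ odd k * fpsX ^+ k.
Proof. by rewrite signr_odd (exprNn fpsX). Qed.

Lemma coef_XN k n : ((- fpsX : fps R) ^+ k) n = (-1) ^+ n * (n == k)%:R.
Proof.
rewrite expr_XN.
have -> : (((-1) ^+ odd k * fpsX ^+ k) n : R) = (-1) ^+ odd k * (n == k)%:R.
  by case: (odd k); rewrite ?expr0 ?mul1r ?expr1 ?mulN1r ?fpsN fpsXn.
by rewrite signr_odd; case: eqP => [->|] //; rewrite !mulr0.
Qed.

(** As [k <= tri k], exponents below [m] come only from indices below [m], and [tri_inj] excludes
    repetitions. *)
Lemma psi_neg_sum m :
  eq_upto m psi_neg (\sum_(k < m) (- fpsX) ^+ tri k).
Proof.
move=> n nm; rewrite fps_sum [LHS]/=.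
under eq_bigr => k _ do rewrite coef_XN.
case: is_triP => [[k kn]|not_tri].
  have km : (k < m)%N by rewrite (leq_ltn_trans (leq_tri k)) ?kn.
  rewrite (bigD1 (Ordinal km)) //= kn eqxx big1 ?addr0 // => i ik.
  case: eqP => [ni|]; last by rewrite mulr0.
  by move: ik; rewrite -(inj_eq val_inj) /= -(inj_eq tri_inj) kn ni eqxx.
rewrite mulr0 big1 // => i _; case: eqP => [ni|]; last by rewrite mulr0.
by case: not_tri; exists i.
Qed.

Definition pod_upto m : fps R := Fps (fun n => (size (pods m n))%:R).
Definition pod_gf : fps R := Fps (fun n => (pod n)%:R).

Lemma pod_upto_gf m : eq_upto m.+1 (pod_upto m) pod_gf.
Proof.
move=> n nm /=; congr (_%:R); rewrite /pod card_pods //.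
apply/perm_size/uniq_perm; try exact: uniq_pods.
by move=> s; rewrite !mem_pods !pod_ofE.
Qed.

Lemma pod_upto0 : pod_upto 0 = 1.
Proof. by apply/fpsP => n; rewrite fps1 /= size_pods0. Qed.

Lemma pod_upto_rec m : pod_upto m.+1 =
  pod_upto m + fpsX ^+ m.+1 * pod_upto (if odd m.+1 then m else m.+1).
Proof.
apply/fpsP => n; rewrite fpsD fpsXnM /= size_pods_succ natrD.
by congr (_ + _); case: leqP.
Qed.

(** This is the recurrence [pS] for [y = - fpsX]: the sign makes [1 - y ^+ n.*2.+1] the factor of a
    part used at most once, while [1 - y ^+ n.*2.+2] is the inverse of the factor of an unrestricted
    part. *)
Lemma pod_upto_double n :
  pod_upto n.+1.*2 * (1 - (- fpsX) ^+ n.*2.+2) =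
  pod_upto n.*2 * (1 - (- fpsX) ^+ n.*2.+1).
Proof.
have := pod_upto_rec n.*2.+1; have := pod_upto_rec n.*2.
rewrite /= negbK odd_double /= doubleS => E1 E2.
rewrite 2!expr_XN /= negbK odd_double /= mul1r mulN1r.
rewrite opprK -doubleS mulrBr mulr1 mulrC {1}E2 doubleS addrK {}E1.
by rewrite mulrDr mulr1 mulrC.
Qed.

(** In Shanks's identity at [n = N.+1], the left side agrees with the product up to degree [N]. On
    the right, [s = 0] contributes 1 and every other term starts at degree at least [n.*2.+1],
    beyond [N]. *)
Lemma pod_gf_psi_neg : pod_gf * psi_neg = 1.
Proof.
apply/fpsP => N; set y : fps R := - fpsX.
have reg n : injective ( *%R (1 - y ^+ n.*2.+2)).
  by apply: fps_mulI; rewrite fpsD fpsN coef_XN fps1 mulr0 subr0.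
have := @shanks _ y (fun k => pod_upto k.*2) pod_upto0 pod_upto_double reg N.+1.
set n := N.+1 => E.
have Nn : (N < n.*2)%N by lia.
have gf : eq_upto n.*2 pod_gf (pod_upto n.*2).
  by move=> m mn; rewrite (@pod_upto_gf n.*2) // ltnW.
rewrite (eq_uptoM gf (@psi_neg_sum n.*2)) // E fps_sum big_ord_recl.
rewrite double0 pod_upto0 mul1r mul0n expr0 big1 ?addr0 // => i _.
rewrite mulrC /y expr_XN -mulrA.
suff E0 : (fpsX ^+ (lift ord0 i * n.*2.+1) * pod_upto (lift ord0 i).*2) N = 0 :> R.
  by case: (odd _); rewrite ?expr0 ?mul1r ?expr1 ?mulN1r ?fpsN E0 ?oppr0.
by rewrite fpsXnM leqNgt lift0; case: ltnP => //; nia.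
Qed.

End Psi.

(** * Triples and the cube of the generating function *)

Section Triple.
Local Open Scope ring_scope.
Variable R : comNzRingType.

Lemma pod_triple_gf n : (pod_triple n)%:R = (pod_gf R ^+ 3) n.
Proof.
pose P (b : bounded_seq n) := pod_partition (parts b).
(* A finite sum, which also contains some partitions of integers above [n]; it is therefore compared
   with [pod_gf] only up to degree [n]. *)
pose f : fps R := \sum_(b | P b) fpsX ^+ sumn (parts b).
have fE : eq_upto n.+1 f (pod_gf R).
  move=> m mn; rewrite /f fps_sum /= /pod card_pods //.
  rewrite -(card_pods (mn : m <= n)%N) -sum1_card natr_sum.
  rewrite big_mkcond [RHS]big_mkcond; apply: eq_bigr => b _.
  rewrite inE -/(P b) fpsXn eq_sym; by case: (P b) => //=; case: eqP.
rewrite -(eq_uptoX 3 fE) // !exprS expr0 mulr1 /f mulr_suml fps_sum.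
rewrite /pod_triple -sum1_card natr_sum.
under [RHS]eq_bigr do rewrite mulr_suml mulr_sumr fps_sum.
under [RHS]eq_bigr do under eq_bigr do rewrite !mulr_sumr fps_sum.
rewrite [RHS]pair_big [RHS]pair_big big_mkcond [RHS]big_mkcond.
apply: eq_bigr => -[[a b] c] _.
rewrite inE -!exprD fpsXn addnA /= -/(P a) -/(P b) -/(P c).
by case: (P a); case: (P b); case: (P c) => //=; rewrite eq_sym; case: eqP.
Qed.
End Triple.

(** * Three-dissection of [psi_neg] *)

Section PsiDissection.
Local Open Scope ring_scope.
Variable R : comNzRingType.

Lemma tri_3q1 k : tri (3 * k + 1) = (9 * tri k + 1)%N.
Proof. by have := tri_double (3 * k + 1); have := tri_double k; nia. Qed.

Lemma tri_mod3 k : (tri k %% 3 = (k %% 3 == 1))%N.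
Proof.
have := tri_double k; rewrite {2 3}(divn_eq k 3) {2}(divn_eq k 3).
move: (k %/ 3)%N (ltn_pmod k (isT : 0 < 3)%N) => q.
by case: (k %% 3)%N => [|[|[|]]] //= _ E; nia.
Qed.

Lemma is_tri_3n1 n : is_tri (3 * n + 1) = (3 %| n)%N && is_tri (n %/ 3).
Proof.
apply/is_triP/andP => [[k kn]|[/dvdnP[m ->]]].
  have := tri_mod3 k; rewrite kn => E.
  have k3 : (k = 3 * (k %/ 3) + 1)%N by lia.
  have := tri_3q1 (k %/ 3); rewrite -k3 kn => E3.
  split; first lia.
  by apply/is_triP; exists (k %/ 3)%N; lia.
rewrite mulnK // => /is_triP[k km]; exists (3 * k + 1)%N.
by rewrite tri_3q1 km; lia.
Qed.

Lemma is_tri_3n2 n : is_tri (3 * n + 2) = false.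
Proof. by apply/is_triP => -[k kn]; have := tri_mod3 k; lia. Qed.

Lemma sect1_psi_neg : sect 1 (psi_neg R) = - dil 3 (psi_neg R).
Proof.
apply/fpsP => n; rewrite sectE fpsN dilE /= is_tri_3n1.
case: ifP => [/dvdnP[m ->]|_]; last by rewrite mulr0 oppr0.
(* The exponent [9 m + 1] has the parity opposite to that of [m], whence the minus sign. *)
rewrite mulnK // -signr_odd -[in RHS]signr_odd oddD oddM oddM /= andbT.
by case: (odd m); rewrite /= ?expr0 ?expr1 ?mulN1r ?mul1r ?opprK.
Qed.

Lemma sect2_psi_neg : sect 2 (psi_neg R) = 0.
Proof. by apply/fpsP => n; rewrite sectE /= is_tri_3n2 mulr0. Qed.

Lemma psi_neg_dissection : psi_neg R =
  dil 3 (sect 0 (psi_neg R)) - fpsX * dil 3 (dil 3 (psi_neg R)).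
Proof.
by rewrite {1}[psi_neg R]dissection sect1_psi_neg sect2_psi_neg; ring.
Qed.

Lemma psi_neg0 : psi_neg R 0%N = 1.
Proof. by rewrite /= mul1r (introT (is_triP 0)) //; exists 0%N. Qed.
End PsiDissection.

(** * Sections of the cube *)

(* Here and below [x], [s], [P], [A] are as in the header. *)
Section Modulo9.
Local Open Scope ring_scope.
Variable R : comNzRingType.
Variables x P A s : fps R.
Hypothesis nine0 : 9 = 0 :> fps R.
Hypothesis cube3 : forall f : fps R, 3 * f ^+ 3 = 3 * dil 3 f.
Hypothesis sE : dil 3 x = s.
Hypothesis xE : x = dil 3 A - fpsX * dil 3 s.
Hypothesis A0 : A 0%N = 1.
Hypothesis Px : P * x = 1.

Let X3 : dil 3 fpsX = fpsX ^+ 3 :> fps R. Proof. exact: dilX. Qed.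

Lemma cube_sections_mod9 :
  sect 1 (P ^+ 3) = 3 * sect 0 (sect 2 P) /\
  sect 2 (P ^+ 3) = 6 * sect 1 (sect 2 P).
Proof.
have [D DE] : exists D, D = A ^+ 3 - fpsX * s ^+ 3 by eexists.
have [Q DQ] : exists Q, D * Q = 1.
  apply: fps_inverse; rewrite DE fpsD fpsN fpsXM subr0 !exprS expr0 !fpsM0 fps1.
  by rewrite A0 !mulr1.
pose a := dil 3 A; pose b := fpsX * dil 3 s; pose q := dil 3 Q.
have SD : dil 3 D = a ^+ 3 - b ^+ 3.
  by rewrite DE /a /b; ring: X3.
have SQ : dil 3 D * q = 1 by rewrite -rmorphM DQ rmorph1.
have D3 : 3 * D = 3 * x.
  by rewrite DE mulrBr [3 * (fpsX * _)]mulrCA !cube3 xE; ring.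
have Q3 : 3 * Q = 3 * P.
  transitivity (3 * x * P * Q); last by rewrite -D3 -[RHS]mulr1 -DQ; ring.
  by rewrite -[LHS]mulr1 -Px; ring.
have s3 : 3 * x ^+ 3 = 3 * s by rewrite cube3 sE.
have x3 : dil 3 D = x ^+ 3 + 3 * a * b * x by rewrite SD xE -/a -/b; ring.
have PD : P ^+ 3 * dil 3 D = 1 + 3 * (a * b * x * P ^+ 3).
  by rewrite x3 mulrDr -exprMn Px expr1n; ring.
(* The correction in [PD] is a multiple of 3 and 9 = 0, so [P ^+ 3] may be replaced by [q] inside
   that correction exactly. *)
have P3q : 3 * P ^+ 3 = 3 * q.
  transitivity (3 * (P ^+ 3 * dil 3 D) * q).
    by rewrite -[LHS]mulr1 -SQ; ring.
  rewrite PD mulrDr mulr1 !mulrA (_ : 3 * 3 = 9 :> fps R); last by ring.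
  by rewrite nine0 !mul0r addr0.
have P3E : P ^+ 3 = q + 3 * (a ^+ 2 * b * q ^+ 2) - 3 * (a * b ^+ 2 * q ^+ 2).
  transitivity (P ^+ 3 * dil 3 D * q); first by rewrite -mulrA SQ mulr1.
  rewrite PD mulrDl mul1r.
  have -> : 3 * (a * b * x * P ^+ 3) * q = a * b * x * q * (3 * P ^+ 3) by ring.
  by rewrite P3q xE -/a -/b; ring.
have [_ P3_1 P3_2] : [/\ sect 0 (P ^+ 3) = Q,
    sect 1 (P ^+ 3) = 3 * (A ^+ 2 * s * Q ^+ 2)
  & sect 2 (P ^+ 3) = - (3 * (A * s ^+ 2 * Q ^+ 2))].
  apply: sect_dissection; rewrite P3E /a /b /q; ring.
have PE : P = (a ^+ 2 + a * b + b ^+ 2) * q.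
  rewrite -[LHS]mulr1 -SQ SD.
  transitivity ((P * x) * (a ^+ 2 + a * b + b ^+ 2) * q); last by rewrite Px; ring.
  by rewrite xE -/a -/b; ring.
have [P_0 P_1 P_2] : [/\ sect 0 P = A ^+ 2 * Q, sect 1 P = A * s * Q
    & sect 2 P = s ^+ 2 * Q].
  apply: sect_dissection; rewrite PE /a /b /q; ring.
(* After multiplication by 3, [Q] becomes [P], whose sections are known, and [s ^+ 2] is
   [dil 3 (x ^+ 2)]; this permits a second dissection. *)
have PP : 3 * sect 2 P = 3 * (s ^+ 2 * P).
  by rewrite P_2 mulrCA Q3; ring.
have [PP_0 PP_1 _] : [/\ sect 0 (3 * sect 2 P) = 3 * (x ^+ 2 * A ^+ 2 * Q),
   sect 1 (3 * sect 2 P) = 3 * (x ^+ 2 * A * s * Q)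
   & sect 2 (3 * sect 2 P) = 3 * (x ^+ 2 * s ^+ 2 * Q)].
  apply: sect_dissection; rewrite PP PE /a /b /q; ring: sE.
have sQ : 3 * (s * Q) = 3 * x ^+ 2.
  transitivity (s * (3 * Q)); first by ring.
  rewrite Q3; transitivity (3 * s * P); first by ring.
  rewrite -s3; transitivity (3 * x ^+ 2 * (P * x)); first by ring.
  by rewrite Px mulr1.
split.
  rewrite P3_1 -sect_natM PP_0.
  transitivity (A ^+ 2 * Q * (3 * (s * Q))); first by ring.
  by rewrite sQ; ring.
rewrite P3_2 (_ : 6 = 2 * 3 :> fps R); last by ring.
rewrite -[RHS]mulrA -sect_natM PP_1.
transitivity (- (A * s * Q * (3 * (s * Q)))); first by ring.
(* The two sides have coefficients -3 and 6, which differ by 9. *)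
rewrite sQ -[LHS]addr0 -(mul0r (A * s * Q * x ^+ 2)) -nine0; ring.
Qed.
End Modulo9.

(** * The sections of the cube modulo 2 *)

Section Modulo2.
Local Open Scope ring_scope.
Variable R : comNzRingType.
Variables x P A s : fps R.
Hypothesis two0 : 2 = 0 :> fps R.
Hypothesis sE : dil 3 x = s.
Hypothesis xE : x = dil 3 A - fpsX * dil 3 s.
Hypothesis A0 : A 0%N = 1.
Hypothesis Px : P * x = 1.
Hypothesis quartic : x * s = x ^+ 4 + fpsX * s ^+ 4.

Let X3 : dil 3 fpsX = fpsX ^+ 3 :> fps R. Proof. exact: dilX. Qed.

(** Reduces a congruence modulo 2 to an exact polynomial identity for [ring]; the witness [w] is
    half the difference of the integral expansions. *)
Let modulo2 (u v w : fps R) : u = v + 2 * w -> u = v.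
Proof. by rewrite two0 mul0r addr0. Qed.

(** The section at multiples of 3 of [x * s] is [A * x] because [s] is [dil 3 x], and [A ^+ 4] by
    [quartic], where all other terms have exponents congruent to 1 modulo 3. Then [A] cancels. *)
Let cubeA : A ^+ 3 = x.
Proof.
apply: (fps_mulI A0).
have x4 : x ^+ 4 = dil 3 A ^+ 4 + (fpsX * dil 3 s) ^+ 4.
  move: (dil 3 A) (fpsX * dil 3 s) xE => a b ->.
  apply: (modulo2
    (w := - 2 * a ^+ 3 * b + 3 * a ^+ 2 * b ^+ 2 - 2 * a * b ^+ 3)); ring.
have [E1 _ _] : [/\ sect 0 (x * s) = A ^+ 4, sect 1 (x * s) = fpsX * s ^+ 4 + x ^+ 4
    & sect 2 (x * s) = 0].
  apply: sect_dissection; rewrite quartic {1}x4; ring: sE X3.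
have [E2 _ _] : [/\ sect 0 (x * s) = A * x, sect 1 (x * s) = - (s * x)
    & sect 2 (x * s) = 0].
  apply: sect_dissection; rewrite {1}xE; ring: sE.
by rewrite -E2 E1.
Qed.

Lemma cube_sections_mod2 : sect 1 (P ^+ 3) = sect 0 (sect 2 P).
Proof.
have [D DE] : exists D, D = A ^+ 3 - fpsX * s ^+ 3 by eexists.
pose a := dil 3 A; pose b := fpsX * dil 3 s.
have Ds : D * s = x ^+ 4.
  transitivity (x * s - fpsX * s ^+ 4); first by rewrite DE cubeA; ring.
  by rewrite quartic addrK.
(* The relation [Ds] makes the inverse of [D] explicit. *)
have [Q QE DQ] : exists2 Q, Q = s * P ^+ 4 & D * Q = 1.
  by exists (s * P ^+ 4); rewrite // mulrA Ds -exprMn mulrC Px expr1n.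
pose q := dil 3 Q.
have SD : dil 3 D = a ^+ 3 - b ^+ 3.
  by rewrite DE /a /b; ring: X3.
have SQ : dil 3 D * q = 1 by rewrite -rmorphM DQ rmorph1.
have PE : P = (a ^+ 2 + a * b + b ^+ 2) * q.
  rewrite -[LHS]mulr1 -SQ SD.
  transitivity ((P * x) * (a ^+ 2 + a * b + b ^+ 2) * q); last by rewrite Px; ring.
  by rewrite xE -/a -/b; ring.
have [_ _ P_2] : [/\ sect 0 P = A ^+ 2 * Q, sect 1 P = A * s * Q
    & sect 2 P = s ^+ 2 * Q].
  apply: sect_dissection; rewrite PE /a /b /q; ring.
have P3 : P ^+ 3 =
    (a ^+ 6 + a ^+ 5 * b + a ^+ 3 * b ^+ 3 + a * b ^+ 5 + b ^+ 6) * q ^+ 3.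
  rewrite PE; apply: (modulo2 (w := (a ^+ 5 * b + 3 * a ^+ 4 * b ^+ 2
     + 3 * a ^+ 3 * b ^+ 3 + 3 * a ^+ 2 * b ^+ 4 + a * b ^+ 5) * q ^+ 3)); ring.
have P4 : P ^+ 4 = (a ^+ 8 + a ^+ 4 * b ^+ 4 + b ^+ 8) * q ^+ 4.
  rewrite PE; apply: (modulo2 (w := (2 * a ^+ 7 * b + 5 * a ^+ 6 * b ^+ 2
     + 8 * a ^+ 5 * b ^+ 3 + 9 * a ^+ 4 * b ^+ 4 + 8 * a ^+ 3 * b ^+ 5
     + 5 * a ^+ 2 * b ^+ 6 + 2 * a * b ^+ 7) * q ^+ 4)); ring.
have [_ -> _] : [/\
    sect 0 (P ^+ 3) = A ^+ 6 * Q ^+ 3 + fpsX * (A ^+ 3 * s ^+ 3 * Q ^+ 3)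
                      + fpsX ^+ 2 * (s ^+ 6 * Q ^+ 3),
    sect 1 (P ^+ 3) = A ^+ 5 * s * Q ^+ 3
  & sect 2 (P ^+ 3) = fpsX * (A * s ^+ 5 * Q ^+ 3)].
  apply: sect_dissection; rewrite P3 /a /b /q; ring: X3.
(* With [Q] replaced by [s * P ^+ 4], the factor [s ^+ 3] is [dil 3 (x ^+ 3)] and only [P ^+ 4]
   needs dissecting. *)
rewrite P_2 (_ : s ^+ 2 * Q = s ^+ 3 * P ^+ 4); last by rewrite QE; ring.
have [-> _ _] : [/\ sect 0 (s ^+ 3 * P ^+ 4) = x ^+ 3 * A ^+ 8 * Q ^+ 4,
    sect 1 (s ^+ 3 * P ^+ 4) = fpsX * (x ^+ 3 * A ^+ 4 * s ^+ 4 * Q ^+ 4)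
  & sect 2 (s ^+ 3 * P ^+ 4) = fpsX ^+ 2 * (x ^+ 3 * s ^+ 8 * Q ^+ 4)].
  apply: sect_dissection; rewrite P4 /a /b /q; ring: sE X3.
(* Inserting [D * Q = 1] brings both sides to the same power of [Q]; then [D * s = x ^+ 4] and one
   factor [x] becomes [A ^+ 3]. *)
transitivity (A ^+ 5 * (D * s) * Q ^+ 4).
  transitivity (A ^+ 5 * s * Q ^+ 3 * (D * Q)); first by rewrite DQ mulr1.
  ring.
by rewrite Ds [x ^+ 4]exprS -{1}cubeA; ring.
Qed.
End Modulo2.

(** * The quartic relation modulo 2 *)

(** The points that are not fixed fall into [Up] and [Dn] according to whether [f] raises or lowers
    the rank, and [f] exchanges these two sets. *)
Lemma odd_card_involution (T : finType) (S : {set T}) (f : T -> T) :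
  {in S, forall x, f x \in S} -> {in S, forall x, f (f x) = x} ->
  odd #|S| = odd #|[set x in S | f x == x]|.
Proof.
move=> fS ffK; pose r := @enum_rank T.
pose Up := [set x in S | r x < r (f x)]; pose Dn := [set x in S | r (f x) < r x].
have rfE x : (f x == x) = (r (f x) == r x :> nat).
  by rewrite (inj_eq val_inj) (inj_eq enum_rank_inj).
have DnE : Dn = f @: Up.
  apply/setP => x; rewrite !inE; apply/andP/imsetP => [[xS xD]|[z]].
    by exists (f x); rewrite ?inE ?fS ?ffK.
  by rewrite inE => /andP[zS zU] ->; rewrite fS ?ffK.
have UD : #|Dn| = #|Up|.
  rewrite DnE card_in_imset // => u v; rewrite !inE => /andP[uS _] /andP[vS _] uv.
  by rewrite -(ffK u) // uv ffK.
have -> : #|S| = #|[set x in S | f x == x]| + (#|Up| + #|Dn|); last first.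
  by rewrite oddD UD addnn odd_double addbF.
rewrite -(cardsID [set x | f x == x] S); congr (_ + _).
  by apply: eq_card => x; rewrite !inE.
by rewrite -(cardsID [set x | r x < r (f x)]); congr (_ + _);
  apply: eq_card => x; rewrite !inE rfE; case: (x \in S);
  rewrite ?andbT ?andbF //=; case: ltngtP.
Qed.

(* With [X = 2 j + 1] and [Y = 2 k + 1], one has
   [8 (tri j + 3 tri k) + 4 = X ^ 2 + 3 Y ^ 2 = 4 (u ^ 2 + 3 v ^ 2)] where
   [X = u + 3 v] and [+-Y = u - v], the sign being the one making [X = +-Y]
   modulo 4; [flip] is the conjugation [v |-> - v], up to signs of [X], [Y]. *)
Definition flip (jk : nat * nat) : nat * nat :=
  let: (j, k) := jk in
  if odd j == odd k then
    (if j <= 3 * k then (3 * k - j)./2 else (j - 3 * k - 2)./2, (j + k)./2)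
  else ((3 * k + j + 1)./2, if k <= j then (j - k - 1)./2 else (k - j - 1)./2).

(** Replaces halvings and truncated subtractions by linear equations, one alternative for each
    branch of [flip]. *)
Lemma flipP j k a b : reflect
  [\/ 3 * k = j + 2 * a /\ j + k = 2 * b,
      j = 3 * k + 2 + 2 * a /\ j + k = 2 * b,
      3 * k + j + 1 = 2 * a /\ j = k + 1 + 2 * b |
      3 * k + j + 1 = 2 * a /\ k = j + 1 + 2 * b]
  (flip (j, k) == (a, b)).
Proof.
rewrite /flip; apply: (iffP idP).
  by case: (odd j =P odd k) => jk; case: leqP => le_jk;
    rewrite xpair_eqE => /andP[/eqP ? /eqP ?];
    [constructor 1|constructor 2|constructor 3|constructor 4]; lia.
by case=> -[E1 E2]; case: (odd j =P odd k) => jk; case: leqP => le_jk;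
  rewrite ?xpair_eqE; lia.
Qed.

Lemma flipK : involutive flip.
Proof.
move=> [j k]; have := eqxx (flip (j, k)); case: {2 3}(flip (j, k)) => a b.
move/flipP => E; apply/eqP/flipP.
(* Alternatives 1 and 3 are self-inverse, while 2 and 4 are exchanged. *)
by case: E => -[E1 E2]; [constructor 1|constructor 4|constructor 3|constructor 2]; lia.
Qed.

Lemma tri_flip jk :
  tri (flip jk).1 + 3 * tri (flip jk).2 = tri jk.1 + 3 * tri jk.2.
Proof.
case: jk => j k; have := eqxx (flip (j, k)); case: {2 3 4}(flip (j, k)) => a b.
move/flipP => E /=.
(* Twice the claim, stated over the integers so that linear relations with subtraction can be
   substituted before [ring]. *)
have norm_eq : (a%:Z * (a%:Z + 1) + 3 * (b%:Z * (b%:Z + 1)) =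
    j%:Z * (j%:Z + 1) + 3 * (k%:Z * (k%:Z + 1)))%R.
  case: E => -[E1 E2].
  - have -> : (a%:Z = 2 * k%:Z - b%:Z)%R by lia.
    have -> : (j%:Z = 2 * b%:Z - k%:Z)%R by lia.
    ring.
  - have -> : (j%:Z = 2 * b%:Z - k%:Z)%R by lia.
    have -> : (a%:Z = b%:Z - 2 * k%:Z - 1)%R by lia.
    ring.
  - have -> : (j%:Z = k%:Z + 1 + 2 * b%:Z)%R by lia.
    have -> : (a%:Z = 2 * k%:Z + b%:Z + 1)%R by lia.
    ring.
  have -> : (a%:Z = 2 * k%:Z - b%:Z)%R by lia.
  have -> : (j%:Z = k%:Z - 1 - 2 * b%:Z)%R by lia.
  ring.
have := tri_double j; have := tri_double k.
have := tri_double a; have := tri_double b.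
by move: norm_eq; lia.
Qed.

(** On these two families [tri j + 3 * tri k] equals [4 * tri k] and [12 * tri k + 1], which will be
    the exponents of [x ^+ 4] and [fpsX * s ^+ 4] modulo 2. *)
Lemma flip_id j k : (flip (j, k) == (j, k)) = (j == k) || (j == 3 * k + 1).
Proof.
apply/flipP/orP => [|[/eqP ->|/eqP ->]].
- by case=> -[E1 E2]; [left|left|right|right]; lia.
- by constructor 1; lia.
by constructor 3; lia.
Qed.

Lemma odd_sum_two_tri N :
  odd #|[set jk : 'I_N.+1 * 'I_N.+1 | tri jk.1 + 3 * tri jk.2 == N]| =
  odd (#|[set k : 'I_N.+1 | 4 * tri k == N]| +
       #|[set k : 'I_N.+1 | 12 * tri k + 1 == N]|).
Proof.
set S := [set jk | _].
(* The default value of [inord] is never met on [S]: by [tri_flip] and [leq_tri] both components of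
   the image are at most [N]. *)
pose f (t : 'I_N.+1 * 'I_N.+1) : 'I_N.+1 * 'I_N.+1 :=
  let u := flip (val t.1, val t.2) in (inord u.1, inord u.2).
have fE t : t \in S -> (val (f t).1, val (f t).2) = flip (val t.1, val t.2).
  rewrite inE => /eqP tN; have := tri_flip (val t.1, val t.2).
  rewrite /f; case: (flip _) => j k /=; rewrite tN => jkN.
  have := leq_tri j; have := leq_tri k => kt jt.
  by rewrite !inordK //; lia.
have S_flip t : t \in S -> f t \in S.
  move=> tS; move: (tS) (fE t tS); rewrite !inE => /eqP tN E.
  have := tri_flip (val t.1, val t.2).
  by rewrite -E /= => ->; apply/eqP.
have val_eq (t u : 'I_N.+1 * 'I_N.+1) :
    (t == u) = ((val t.1, val t.2) == (val u.1, val u.2)).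
  by case: t u => [t1 t2] [u1 u2].
rewrite (odd_card_involution (f := f)) //; last first.
  move=> t tS; apply/eqP.
  by rewrite val_eq (fE _ (S_flip t tS)) (fE _ tS) flipK.
set F := [set x in S | _].
have inF t : t \in F =
    (t \in S) && ((val t.1 == val t.2) || (val t.1 == 3 * val t.2 + 1)).
  rewrite inE; case: (boolP (t \in S)) => //= tS.
  by rewrite val_eq fE // flip_id.
(* The diagonal separates the two families of fixed points, since [k] never equals [3 * k + 1]. *)
congr odd; rewrite -(cardsID [set t | t.1 == t.2] F); congr (_ + _).
  have diag_inj : injective (fun k : 'I_N.+1 => (k, k)) by move=> ? ? [].
  rewrite -[RHS](card_imset _ diag_inj); apply: eq_card => -[j k].
  rewrite in_setI inF !inE /=; apply/idP/imsetP => [/andP[/andP[/eqP jkN _] /eqP jk]|].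
    by exists k; rewrite ?inE ?jk //; move: jkN; rewrite jk; lia.
  case=> k'; rewrite inE => /eqP k'N [-> ->]; rewrite !eqxx /= andbT andbT.
  by move: k'N; lia.
have sec_inj : injective (fun k : 'I_N.+1 => (inord (3 * k + 1) : 'I_N.+1, k)).
  by move=> ? ? [].
rewrite -[RHS](card_imset _ sec_inj); apply: eq_card => -[j k].
rewrite in_setD inF !inE /= -[j == k]val_eqE /=; apply/idP/imsetP.
  move=> /and3P[/negbTE jk /eqP jkN]; rewrite jk /= => /eqP jE.
  exists k; last by rewrite -jE inord_val.
  by rewrite inE; move: jkN; rewrite jE tri_3q1; lia.
case=> k'; rewrite inE => /eqP k'N [-> ->].
have kN : 3 * k' + 1 < N.+1 by have := leq_tri k'; lia.
by rewrite inordK // tri_3q1 eqxx orbT; lia.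
Qed.

Section QuarticModulo2.
Local Open Scope ring_scope.
Notation R := 'Z_2.
Let x : fps R := psi_neg R.
Let s : fps R := dil 3 x.
Let two0 : 2 = 0 :> fps R.
Proof. by apply: natr_fps_eq0; apply/val_inj. Qed.

Let square (f : fps R) : f ^+ 2 = dil 2 f.
Proof.
apply: fps_square => [|c]; first exact/val_inj.
by case: c => -[|[|]] // ?; apply/val_inj.
Qed.

Let natr_odd m n : odd m = odd n -> m%:R = n%:R :> R.
Proof.
move=> mn; rewrite -(odd_double_half m) -(odd_double_half n) mn !natrD.
have dbl0 k : k.*2%:R = 0 :> R.
  by rewrite -muln2 natrM (_ : 2 = 0 :> R) ?mulr0 //; apply/val_inj.
by rewrite !dbl0.
Qed.

(** Signs disappear modulo 2 and a fourth power is the substitution of [q^4] for [q], so coefficient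
    [N] on each side counts the solutions compared in [odd_sum_two_tri]. *)
Lemma psi_quartic_mod2 : x * s = x ^+ 4 + fpsX * s ^+ 4.
Proof.
apply/fpsP => N; pose t : fps R := \sum_(k < N.+1) fpsX ^+ tri k.
have xt : eq_upto N.+1 x t.
  have -> : t = \sum_(k < N.+1) (- fpsX) ^+ tri k; last exact: psi_neg_sum.
  apply: eq_bigr => k _; congr (_ ^+ _); apply/eqP.
  by rewrite -subr_eq0 opprK -mulr2n -mulr_natl two0 mul0r.
have st : eq_upto N.+1 s (dil 3 t) by apply: eq_upto_dil.
have quartic (f : fps R) : f ^+ 4 = dil 2 (dil 2 f) by rewrite -!square -exprM.
rewrite fpsD (eq_uptoM xt st) // (eq_uptoX 4 xt) //.
rewrite (eq_uptoM (fun n _ => erefl (fpsX n)) (eq_uptoX 4 st)) //.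
rewrite !quartic /t !dil_sumX // big_distrlr pair_big mulr_sumr /=.
under eq_bigr do rewrite -exprD.
under [X in _ = _ + coef X N]eq_bigr do rewrite -exprS.
rewrite (coef_sumX _ (fun jk : 'I_N.+1 * 'I_N.+1 => tri jk.1 + 3 * tri jk.2)%N).
rewrite (natr_odd (odd_sum_two_tri N)) natrD !coef_sumX.
congr (_%:R + _%:R); apply: eq_card => k; rewrite !inE; lia.
Qed.

End QuarticModulo2.

(** * Specialization to the residue rings and conclusion *)

Section Sections.
Local Open Scope ring_scope.

Lemma pod_sections_mod9 : let P := pod_gf 'Z_9 in
  sect 1 (P ^+ 3) = 3 * sect 0 (sect 2 P) /\
  sect 2 (P ^+ 3) = 6 * sect 1 (sect 2 P).
Proof.
apply: (cube_sections_mod9 (x := psi_neg _)) (erefl _) _ _ _.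
- by apply: natr_fps_eq0; apply/val_inj.
- apply: fps_cube => [|c]; first exact/val_inj.
  by case: c => -[|[|[|[|[|[|[|[|[|]]]]]]]]] // ?; apply/val_inj.
- exact: psi_neg_dissection.
- by rewrite sectE psi_neg0.
exact: pod_gf_psi_neg.
Qed.

Lemma pod_sections_mod2 : let P := pod_gf 'Z_2 in
  sect 1 (P ^+ 3) = sect 0 (sect 2 P).
Proof.
apply: (cube_sections_mod2 (x := psi_neg _)) (erefl _) _ _ _ _.
- by apply: natr_fps_eq0; apply/val_inj.
- exact: psi_neg_dissection.
- by rewrite sectE psi_neg0.
- exact: pod_gf_psi_neg.
exact: psi_quartic_mod2.
Qed.
End Sections.

Theorem theorem3p1 (n : nat) :
  pod_triple (3 * n + 2) = 6 * pod (9 * n + 5) %[mod 9] /\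
  pod_triple (3 * n + 1) = 3 * pod (9 * n + 2) %[mod 18].
Proof.
have Zp_eq m u v : 1 < m -> (u%:R = v%:R :> 'Z_m)%R -> u = v %[mod m].
  by move=> m1 /(congr1 (@nat_of_ord _)); rewrite !val_Zp_nat.
have [mod9_1 mod9_2] := pod_sections_mod9.
split.
  apply: Zp_eq => //; rewrite pod_triple_gf natrM.
  have := congr1 (fun f : fps 'Z_9 => f n) mod9_2; rewrite fps_natM !sectE => ->.
  (* The index of section 1 inside section 2 is [3 * (3 * n + 1) + 2], which is [9 * n + 5]. *)
  by congr (_ * (pod _)%:R)%R; lia.
(* The congruence modulo 18 splits into one modulo 9 and one modulo 2; in the latter the factor 3
   reduces to 1. *)
apply/eqP; rewrite (@chinese_remainder 9 2) //; apply/andP; split; apply/eqP.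
  apply: Zp_eq => //; rewrite pod_triple_gf natrM.
  have := congr1 (fun f : fps 'Z_9 => f n) mod9_1; rewrite fps_natM !sectE => ->.
  by congr (_ * (pod _)%:R)%R; lia.
rewrite -modnMml; apply: Zp_eq => //; rewrite pod_triple_gf mul1n.
have := congr1 (fun f : fps 'Z_2 => f n) pod_sections_mod2; rewrite !sectE => ->.
by congr (pod _)%:R%R; lia.
Qed.
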